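(* Let $k\ge1$ and let $\widetilde P=(\widetilde p_{i,j})$ and $P=(p_{i,j})$ be two stochastic matrices on the state space $E=\{0,\dots,k\}$. Suppose that $\widetilde p_{k,k}=p_{k,k}=1$ and that ${}_{(k)}\widetilde P$ is ergodic. Assume furthermore that $\lambda(\widetilde P)<\lambda(P)$. Then there exists $n_0$ such that $\widetilde P^{\,n}\unlhd P^{\,n}$ for every $n\ge n_0$.
   Context: For probability distributions $\mu,\nu$ on $\{0,\dots,k\}$, $\mu\preceq_{st}\nu$ means $\sum_{l=j}^k\mu_l\le\sum_{l=j}^k\nu_l$ for every $j=0,\dots,k$. For stochastic matrices $A=(a_{i,j})_{i,j=0,\dots,k}$ and $A'=(a'_{i,j})_{i,j=0,\dots,k}$, write $A'\unlhd A$ if and only if $a'_{i,\cdot}\preceq_{st}a_{j,\cdot}$ for all $0\le i\le j\le k$, where $a_{j,\cdot}$ is the $j$-th row of $A$ and $a'_{i,\cdot}$ the $i$-th row of $A'$. Taboo matrix: for a stochastic matrix $Q=(q_{i,j})_{i,j=0,\dots,k}$ with $q_{i,k}<1$ for $i=0,\dots,k-1$, ${}_{(k)}Q=({}_{(k)}q_{i,j})_{i,j=0,\dots,k-1}$ is the stochastic matrix with entries ${}_{(k)}q_{i,j}=q_{i,j}/(1-q_{i,k})$. (Writing ${}_{(k)}\widetilde P$ presupposes $\widetilde p_{i,k}<1$ for $i=0,\dots,k-1$.) A stochastic matrix is called ergodic if some positive integer power of it has all entries strictly positive. Spectral gap: $\lambda(Q)=1-\mu(Q)$, where $\mu(Q)$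 is the modulus of the second eigenvalue of $Q$, i.e. the second largest term when the moduli of the (complex) eigenvalues of $Q$, counted with algebraic multiplicity, are listed in decreasing order (so $\mu(Q)=1$ when $1$ is a multiple eigenvalue). *)

(* Defs.v *)
From HB Require Import structures.
From mathcomp Require Import all_boot all_order all_algebra.
From mathcomp Require Import complex.
From mathcomp Require Import reals.

Set Implicit Arguments.
Unset Strict Implicit.
Unset Printing Implicit Defensive.

Import Order.TTheory GRing.Theory Num.Theory.
Local Open Scope ring_scope.

Section StochasticMatrices.
Variable R : realType.

Definition stochastic (n : nat) (Q : 'M[R]_n) : Prop :=
  (forall i j, 0 <= Q i j) /\ (forall i, \sum_j Q i j = 1).

Definition st_le (n : nat) (mu nu : 'rV[R]_n) : Prop :=
  forall j : 'I_n,
    \sum_(l < n | (j <= l)%N) mu 0 l <= \sum_(l < n | (j <= l)%N) nu 0 l.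

Definition mx_st_le (n : nat) (A' A : 'M[R]_n) : Prop :=
  forall i j : 'I_n, (i <= j)%N -> st_le (row i A') (row j A).

(* The last state is [ord_max]. As [x / 0 = 0], this is the conditioned chain
   only when [Q i k < 1] for every [i < k]. *)
Definition taboo (k : nat) (Q : 'M[R]_k.+1) : 'M[R]_k :=
  \matrix_(i < k, j < k)
    (Q (widen_ord (leqnSn k) i) (widen_ord (leqnSn k) j)
       / (1 - Q (widen_ord (leqnSn k) i) ord_max)).

Definition ergodic (n : nat) (Q : 'M[R]_n) : Prop :=
  exists2 m : nat, (0 < m)%N & forall i j, 0 < (Q ^+ m) i j.

(* As [char_poly] is monic, of degree [n], these are the [n] complex
   eigenvalues, each repeated according to its algebraic multiplicity. *)
Definition eigenvalues (n : nat) (Q : 'M[R]_n) : seq R[i] :=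
  sval (closed_field_poly_normal (char_poly (map_mx (real_complex R) Q))).

(* The second largest modulus, at index 1 of the nonincreasing list; this is
   meaningful for [n >= 2], and is 0 by default otherwise. *)
Definition second_modulus (n : nat) (Q : 'M[R]_n) : R :=
  (sort >=%R [seq ComplexField.Normc.normc z | z <- eigenvalues Q])`_1.

Definition spectral_gap (n : nat) (Q : 'M[R]_n) : R := 1 - second_modulus Q.

End StochasticMatrices.

(* Main.v *)
(** Restrict both matrices to the states [0, ..., k-1], giving substochastic
    matrices [Qt] and [Q].  The eigenvalues of [P] are 1 and those of [Q], so
    the second modulus [s] of [P] is the spectral radius of [Q]; likewise that
    of [Pt], say [r], is the spectral radius of [Qt], and the gap hypothesis says
    [s < r].  Some power of [Qt] is entrywise positive, hence all entries of
    [Qt ^+ n] are at least [c * r ^+ n] with [c > 0], while those of [Q ^+ n] are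
    at most [C * x ^+ n] for any [x] in [(s, r)].  So, for [n] large, the
    chain [Pt] started at [i < k] is in state 0 with larger probability than the
    chain [P] started at [j < k] is in any of the states below [k]; the
    remaining case [j = k] is trivial. *)
Require Import Defs.
From mathcomp Require Import all_boot all_order all_algebra.
From mathcomp Require Import complex.
From mathcomp Require Import reals ring lra.

Import Order.TTheory GRing.Theory Num.Theory.
Local Open Scope ring_scope.

Local Notation normc := ComplexField.Normc.normc.
Local Notation mxC Q := (map_mx (real_complex _) Q).

(** * Moduli of complex numbers as real numbers *)

Section NormC.
Local Set Implicit Arguments.
Local Unset Strict Implicit.
Variable R : rcfType.
Implicit Type z : R[i].

Lemma normc_normr z : (normc z)%:C%C = `|z|.
Proof. by case: z. Qed.

Lemma normc_ge0 z : 0 <= normc z.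
Proof. by rewrite -lecR normc_normr normr_ge0. Qed.

Lemma ler_normc_sum (I : Type) (r : seq I) (F : I -> R[i]) :
  normc (\sum_(i <- r) F i) <= \sum_(i <- r) normc (F i).
Proof.
elim/big_ind2: _ => [|x a y b xa yb|//]; first by rewrite ComplexField.Normc.normc0.
exact: le_trans (le_normcD _ _) (lerD xa yb).
Qed.

Lemma normc_real (x : R) : normc x%:C%C = `|x|.
Proof. by rewrite /normc /= expr0n addr0 sqrtr_sqr. Qed.

End NormC.

(** * Growth of the powers of a nonnegative matrix *)

Section NonnegativeMatrices.
Local Set Implicit Arguments.
Local Unset Strict Implicit.
Variable R : realType.
Implicit Types k n m : nat.

Lemma expmx_ge0 n (A : 'M[R]_n) : (forall i j, 0 <= A i j) ->
  forall m i j, 0 <= (A ^+ m) i j.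
Proof.
move=> A0; elim=> [|m IH] i j; first by rewrite expr0 mxE ler0n.
by rewrite exprS mxE sumr_ge0 // => l _; rewrite mulr_ge0.
Qed.

(** A positive entry of [A ^+ m] comes from a path of positive entries of [A], and [B] has the same
    path. This carries the ergodicity of [taboo Pt] over to [transient Pt]. *)
Lemma expmx_gt0_support n (A B : 'M[R]_n) :
  (forall i j, 0 <= A i j) -> (forall i j, 0 <= B i j) ->
  (forall i j, 0 < A i j -> 0 < B i j) ->
  forall m i j, 0 < (A ^+ m) i j -> 0 < (B ^+ m) i j.
Proof.
move=> A0 B0 AB; elim=> [|m IH] i j; first by rewrite !expr0 !mxE.
rewrite !exprS !mxE => /lt0r_neq0; rewrite psumr_neq0; last first.
  by move=> l _; rewrite mulr_ge0 // expmx_ge0.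
case/hasP=> l _ /=.
move=> h; have Al : A i l != 0 by apply: contraL h => /eqP->; rewrite mul0r ltxx.
have {}Al : 0 < A i l by rewrite lt0r Al A0.
rewrite pmulr_rgt0 // in h.
apply: lt_le_trans (_ : B i l * (B ^+ m) l j <= _).
  by rewrite mulr_gt0 ?AB ?IH.
rewrite (bigD1 l) //= lerDl sumr_ge0 // => p _.
by rewrite mulr_ge0 // expmx_ge0.
Qed.

(* Take the moduli of the coordinates of a left eigenvector. *)
Lemma eigenvalue_sub_eigenvector n (A : 'M[R]_n) z :
  (forall i j, 0 <= A i j) -> root (char_poly (mxC A)) z ->
  exists u : 'rV[R]_n,
    [/\ forall j, 0 <= u 0 j, 0 < \sum_j u 0 j
      & forall j, normc z * u 0 j <= (u *m A) 0 j].
Proof.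
move=> A0; rewrite -eigenvalue_root_char => /eigenvalueP[v vA v0].
exists (map_mx (@normc R) v); split=> [j||j].
- by rewrite mxE normc_ge0.
- rewrite lt0r sumr_ge0 ?andbT => [|j _]; last by rewrite mxE normc_ge0.
  apply: contra v0 => /eqP s0; apply/eqP/rowP=> j; rewrite [RHS]mxE.
  apply: ComplexField.Normc.eq0_normc.
  have := psumr_eq0P _ s0 (i := j) isT; rewrite mxE; apply=> i _.
  by rewrite mxE normc_ge0.
- rewrite !mxE -ComplexField.Normc.normcM.
  have -> : z * v 0 j = (z *: v) 0 j by rewrite mxE.
  rewrite -vA mxE; apply: le_trans; first exact: ler_normc_sum.
  apply: ler_sum => i _; rewrite ComplexField.Normc.normcM !mxE normc_real.
  by rewrite (ger0_norm (A0 _ _)).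
Qed.

Lemma sub_eigenvector_expmx n (A : 'M[R]_n) r (u : 'rV[R]_n) :
  (forall i j, 0 <= A i j) -> 0 <= r ->
  (forall j, r * u 0 j <= (u *m A) 0 j) ->
  forall m j, r ^+ m * u 0 j <= (u *m A ^+ m) 0 j.
Proof.
move=> A0 r0 uA; elim=> [|m IH] j; first by rewrite !expr0 mul1r mulmx1.
have -> : u *m A ^+ m.+1 = (u *m A ^+ m) *m A by rewrite exprSr mulmxA.
rewrite exprSr -mulrA; apply: le_trans (ler_wpM2l (exprn_ge0 m r0) (uA j)) _.
rewrite !mxE mulr_sumr ler_sum // => i _.
by rewrite mulrA ler_wpM2r.
Qed.

(** The sum of all entries of [A ^+ p] is at least [normc z ^+ p]; multiplying by the positive
    matrix [A ^+ m] on both sides passes a fixed share of this sum to every entry. *)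
Lemma expmx_lower_bound n (A : 'M[R]_n.+1) (m : nat) z :
  (forall i j, 0 <= A i j) -> (forall i j, 0 < (A ^+ m) i j) ->
  root (char_poly (mxC A)) z ->
  exists2 c, 0 < c & forall p i j, c * normc z ^+ p <= (A ^+ (m + p + m)) i j.
Proof.
move=> A0 Am /(eigenvalue_sub_eigenvector A0)[u [u0 us uA]].
have uAp := sub_eigenvector_expmx A0 (normc_ge0 z) uA.
set S := \sum_j u 0 j in us.
have uS j : u 0 j <= S by rewrite /S (bigD1 j) //= lerDl sumr_ge0.
pose d := \big[Num.min/1]_(ij : 'I_n.+1 * 'I_n.+1) (A ^+ m) ij.1 ij.2.
have d0 : 0 < d by apply/Order.TotalTheory.bigmin_gtP; split.
have dA i j : d <= (A ^+ m) i j by apply: (Order.TotalTheory.bigmin_le_cond _ (j := (i, j))).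
have Ap0 := expmx_ge0 A0.
exists (d * d) => [|p i j]; first exact: mulr_gt0.
(* Sum the sub-eigenvector inequality over the coordinates, bound each [u 0 a] by [S], and cancel
   [S]. *)
have tot : normc z ^+ p <= \sum_a \sum_b (A ^+ p) a b.
  rewrite -(ler_pM2l us) mulrC -/S {1}/S mulr_sumr.
  apply: le_trans (ler_sum _ (fun j _ => uAp p j)) _.
  under eq_bigr do rewrite mxE.
  rewrite exchange_big mulr_sumr ler_sum // => a _.
  by rewrite mulr_sumr ler_sum // => b _; rewrite ler_wpM2r.
apply: le_trans (ler_wpM2l (ltW (mulr_gt0 d0 d0)) tot) _.
rewrite 2!exprD !mxE exchange_big /= mulr_sumr.
apply: ler_sum => b _; rewrite mxE mulr_sumr mulr_suml ler_sum // => a _.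
by rewrite mulrAC ler_pM // ?mulr_ge0 ?(ltW d0) // ler_pM // ltW.
Qed.

(* Cayley-Hamilton annihilates [A ^+ m] after applying the difference operators
   [a |-> (m |-> a (m + 1) - z * a m)] for all eigenvalues [z]; each is undone
   at the cost of a larger constant. *)
Lemma expmx_upper_bound n (A : 'M[R]_n.+1) s x :
  0 <= s < x -> (forall z, root (char_poly (mxC A)) z -> normc z <= s) ->
  exists2 C, 0 <= C & forall m i j, (A ^+ m) i j <= C * x ^+ m.
Proof.
move=> /andP[s0 sx] roots_s; set B := mxC A.
have x0 : 0 < x := le_lt_trans s0 sx.
pose bounded p := exists2 C, 0 <= C & forall m i j,
  normc ((B ^+ m * horner_mx B p) i j) <= C * x ^+ m.
have step p z : normc z <= s -> bounded (p * ('X - z%:P)) -> bounded p.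
  move=> zs [C C0 pC]; pose D := \sum_i \sum_j normc (horner_mx B p i j).
  have D0 : 0 <= D by do 2!rewrite sumr_ge0 // => ? _; exact: normc_ge0.
  have xs : 0 < x - s by rewrite subr_gt0.
  (* This constant [K] must satisfy [D <= K], for [m = 0], and [s * K + C <= K * x], for the
     recurrence below. *)
  exists (D + C / (x - s)) => [|m i j].
    by rewrite addr_ge0 // divr_ge0 // ltW.
  elim: m => [|m IH].
    rewrite !expr0 mul1r mulr1; apply: le_trans (_ : D <= _).
      rewrite /D (bigD1 i) //= (bigD1 j) //= -addrA lerDl addr_ge0 ?sumr_ge0 //.
        by move=> ? _; exact: normc_ge0.
      by move=> ? _; rewrite sumr_ge0 // => ? _; exact: normc_ge0.
    by rewrite lerDl divr_ge0 // ltW.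
  have -> : (B ^+ m.+1 * horner_mx B p) i j
      = z * (B ^+ m * horner_mx B p) i j
        + (B ^+ m * horner_mx B (p * ('X - z%:P))) i j.
    rewrite (mulrC p) rmorphM /= rmorphB /= horner_mx_X horner_mx_C mulrA mulrBr.
    rewrite -exprSr.
    have -> : B ^+ m * z%:M = z *: B ^+ m by rewrite -mul_mx_scalar.
    rewrite mulrBl -scalerAl.
    have mxB (U V : 'M_n.+1) : (U - z *: V) i j = U i j - z * V i j by rewrite !mxE.
    by rewrite mxB addrCA subrr addr0.
  apply: le_trans (le_normcD _ _) _; rewrite ComplexField.Normc.normcM.
  apply: le_trans (lerD (ler_pM (normc_ge0 _) (normc_ge0 _) zs IH) (pC m i j)) _.
  rewrite mulrA -mulrDl exprS [x * _]mulrC mulrA [_ * x]mulrAC.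
  apply: ler_wpM2r; first by rewrite exprn_ge0 // ltW.
  rewrite -subr_ge0.
  have -> : (D + C / (x - s)) * x - (s * (D + C / (x - s)) + C)
     = D * (x - s) + (C / (x - s) * (x - s) - C) by ring.
  by rewrite divfK ?gt_eqF // subrr addr0 mulr_ge0 // ltW.
have peel rs p : all (fun z => normc z <= s) rs ->
    bounded (p * \prod_(z <- rs) ('X - z%:P)) -> bounded p.
  elim: rs p => [|z rs IH] p /=; first by rewrite big_nil mulr1.
  case/andP=> zs rss; rewrite big_cons mulrA => /(IH _ rss); exact: step.
(* Start from the full characteristic polynomial, where the bound holds with constant 0, and remove
   its linear factors one at a time. *)
have [C C0 AC] : bounded 1.
  have [rs chB] := closed_field_poly_normal (char_poly B).
  rewrite (monicP (char_poly_monic B)) scale1r in chB.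
  apply: (peel rs); last first.
    exists 0 => // m i j; rewrite mul1r -chB Cayley_Hamilton.
    by rewrite mulr0 mxE ComplexField.Normc.normc0 mul0r.
  by apply/allP=> z zrs; apply: roots_s; rewrite chB root_prod_XsubC.
exists C => // m i j; apply: le_trans (AC m i j).
rewrite rmorph1 mulr1 -(rmorphXn (@map_mx _ _ (real_complex R) _ _)) /= mxE normc_real.
exact: ler_norm.
Qed.

(** A Bernoulli-type inequality makes [(r / x) ^+ n] grow at least linearly, so it eventually
    exceeds [C / c]. *)
Lemma eventually_geometric_le (r x c C : R) : 0 < x < r -> 0 < c ->
  exists n0, forall n, (n0 <= n)%N -> C * x ^+ n <= c * r ^+ n.
Proof.
move=> /andP[x0 xr] c0; pose h := r / x - 1.
have h0 : 0 < h by rewrite subr_gt0 ltr_pdivlMr // mul1r.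
have bern n : h *+ n <= (r / x) ^+ n.
  elim: n => [|n IH]; first by rewrite expr0 mulr0n.
  have rx1 : 1 <= (r / x) ^+ n by rewrite exprn_ege1 // -subr_ge0 ltW.
  have rxE : r / x = h + 1 by rewrite subrK.
  by rewrite exprS {1}rxE mulrDl mul1r mulrS lerD // ler_peMr // ltW.
exists (Num.bound `|C / c / h|) => n nb.
have : `|C / c / h| <= n%:R.
  by apply: le_trans (ltW (archi_boundP _)) _; rewrite ?ler_nat.
move=> /(le_trans (ler_norm _)); rewrite ler_pdivrMr // mulr_natl.
move=> /le_trans/(_ (bern n)); rewrite ler_pdivrMr // expr_div_n mulrAC.
by rewrite ler_pdivlMr ?exprn_gt0 // [_ * c]mulrC.
Qed.

End NonnegativeMatrices.

(** * Chains absorbed in the last state: powers and spectrum *)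

Section AbsorbingLastState.
Local Set Implicit Arguments.
Local Unset Strict Implicit.
Variable R : realType.
Implicit Type k : nat.

Definition transient (T : pzSemiRingType) k (A : 'M[T]_k.+1) : 'M[T]_k :=
  \matrix_(i, j) A (widen_ord (leqnSn k) i) (widen_ord (leqnSn k) j).

Definition absorbing k (A : 'M[R]_k.+1) :=
  stochastic A /\ A ord_max ord_max = 1.

Lemma absorbing_row k (A : 'M[R]_k.+1) : absorbing A ->
  forall j, A ord_max (widen_ord (leqnSn k) j) = 0.
Proof.
case=> [[A0 A1] Akk] j; apply: (psumr_eq0P (P := xpredT) (F := fun j =>
  A ord_max (widen_ord (leqnSn k) j))) => //.
by apply: (addIr 1); rewrite add0r -{1}Akk -(A1 ord_max) big_ord_recr.
Qed.

Lemma stochastic_mul k (A B : 'M[R]_k) :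
  stochastic A -> stochastic B -> stochastic (A *m B).
Proof.
move=> [A0 A1] [B0 B1]; split=> [i j|i].
  by rewrite mxE sumr_ge0 // => l _; rewrite mulr_ge0.
under eq_bigr do rewrite mxE.
rewrite exchange_big -[RHS](A1 i) /=; apply: eq_bigr => l _.
by rewrite -mulr_sumr B1 mulr1.
Qed.

Lemma absorbing_exp k (A : 'M[R]_k.+1) n : absorbing A -> absorbing (A ^+ n).
Proof.
move=> hA; elim: n => [|n [An Ankk]].
  rewrite expr0; split; last by rewrite mxE eqxx.
  split=> [i j|i]; first by rewrite mxE ler0n.
  rewrite (bigD1 i) //= mxE eqxx big1 ?addr0 // => j ji.
  by rewrite mxE eq_sym (negPf ji).
rewrite exprS; split; first exact: stochastic_mul hA.1 An.
rewrite mxE big_ord_recr /= hA.2 Ankk mul1r big1 ?add0r // => l _.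
by rewrite absorbing_row // mul0r.
Qed.

(** A path between states below the last one cannot pass through the absorbing state. *)
Lemma transient_exp k (A : 'M[R]_k.+1) n : absorbing A ->
  transient (A ^+ n) = transient A ^+ n.
Proof.
move=> hA; elim: n => [|n IH]; apply/matrixP=> i j.
  by rewrite !expr0 !mxE.
rewrite !exprS -IH !mxE big_ord_recr /= (absorbing_row (absorbing_exp n hA)).
by rewrite mulr0 addr0; apply: eq_bigr => l _; rewrite !mxE.
Qed.

(** Expand the determinant along the last row, whose only nonzero entry is the diagonal one. *)
Lemma char_poly_absorbing k (A : 'M[R]_k.+1) : absorbing A ->
  char_poly (mxC A) = ('X - 1%:P) * char_poly (mxC (transient A)).
Proof.
move=> hA; rewrite /char_poly (expand_det_row _ ord_max) big_ord_recr /= big1.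
  rewrite add0r !mxE eqxx mulr1n hA.2 /cofactor addnn -mul2n exprM sqrrN !expr1n.
  rewrite mul1r; congr (_ * \det _); apply/matrixP=> i j; rewrite !mxE.
  have lw (l : 'I_k) : lift ord_max l = widen_ord (leqnSn k) l.
    by apply: val_inj; exact: lift_max.
  by rewrite !lw.
move=> j _; rewrite !mxE absorbing_row // rmorph0 subr0 -val_eqE /=.
by rewrite gtn_eqF // mulr0n mul0r.
Qed.

Lemma char_poly_eigenvalues k (Q : 'M[R]_k) :
  char_poly (mxC Q) = \prod_(z <- eigenvalues Q) ('X - z%:P).
Proof.
rewrite /eigenvalues; case: closed_field_poly_normal => s /= {1}->.
by rewrite (monicP (char_poly_monic _)) scale1r.
Qed.

Lemma mem_eigenvalues k (Q : 'M[R]_k) z :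
  (z \in eigenvalues Q) = root (char_poly (mxC Q)) z.
Proof. by rewrite char_poly_eigenvalues root_prod_XsubC. Qed.

Lemma stochastic_eigenvalue_le1 k (A : 'M[R]_k) z : stochastic A ->
  z \in eigenvalues A -> normc z <= 1.
Proof.
rewrite mem_eigenvalues => -[A0 A1].
case/(eigenvalue_sub_eigenvector A0) => u [u0 us uA].
rewrite -(ler_pM2r us) mul1r mulr_sumr.
apply: le_trans (ler_sum _ (fun j _ => uA j)) _.
under eq_bigr do rewrite mxE.
rewrite exchange_big ler_sum // => i _.
by rewrite -mulr_sumr A1 mulr1.
Qed.

(** The eigenvalue 1 contributed by the absorbing state dominates all moduli, so it can head the
    sorted list; index 1 then holds the spectral radius of the transient block. As [0 < k], this is
    a genuine entry and not the default 0. *)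
Lemma second_modulus_absorbing k (A : 'M[R]_k.+1) : (0 < k)%N -> absorbing A ->
  (exists2 z, root (char_poly (mxC (transient A))) z & normc z = second_modulus A)
  /\ (forall z, root (char_poly (mxC (transient A))) z -> normc z <= second_modulus A).
Proof.
move=> k0 hA.
have eigA : perm_eq (eigenvalues A) (1 :: eigenvalues (transient A)).
  apply: prod_XsubC_eq; rewrite big_cons -!char_poly_eigenvalues.
  exact: char_poly_absorbing.
pose t := [seq normc z | z <- eigenvalues (transient A)].
have ge_trans : transitive (>=%R : rel R) by move=> a b c /[swap]; apply: le_trans.
have ge_anti : antisymmetric (>=%R : rel R).
  by move=> a b; rewrite andbC; apply: le_anti.
have ge_total : total (>=%R : rel R) by move=> a b; apply: le_total.
have sorted_t := sort_sorted ge_total t.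
have -> : second_modulus A = (sort >=%R t)`_0.
  rewrite /second_modulus.
  suff -> : sort >=%R [seq normc z | z <- eigenvalues A] = 1 :: sort >=%R t by [].
  apply: (sorted_eq ge_trans ge_anti); first exact: sort_sorted.
    rewrite /= path_min_sorted ?sort_sorted //; apply/allP=> y.
    rewrite mem_sort => /mapP[z zt ->].
    apply: stochastic_eigenvalue_le1 hA.1 _.
    by rewrite (perm_mem eigA) inE zt orbT.
  rewrite perm_sort; apply: perm_trans (perm_map _ eigA) _.
  by rewrite map_cons ComplexField.Normc.normc1 perm_cons perm_sym perm_sort.
have size_t : size (sort >=%R t) = k.
  rewrite size_sort size_map; apply: succn_inj.
  by rewrite -(size_prod_XsubC _ id) -char_poly_eigenvalues size_char_poly.
split=> [|z].
  have : (sort >=%R t)`_0 \in t by rewrite -(mem_sort >=%R) mem_nth // size_t.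
  by case/mapP=> z; rewrite mem_eigenvalues => ? ->; exists z.
rewrite -mem_eigenvalues => /(map_f (@ComplexField.Normc.normc R)).
rewrite -/t -(mem_sort >=%R); case: (sort _ _) sorted_t => // a l /= al.
rewrite inE => /predU1P[->//|].
by move: al; rewrite (path_sortedE ge_trans) => /andP[/allP + _]; apply.
Qed.

(** Passing from tails to heads leaves only sums over states strictly below some [j], which never
    include the absorbing state. *)
Lemma st_le_complement k (mu nu : 'rV[R]_k) :
  \sum_j mu 0 j = \sum_j nu 0 j ->
  (forall j : 'I_k, \sum_(l < k | (l < j)%N) nu 0 l <= \sum_(l < k | (l < j)%N) mu 0 l) ->
  st_le mu nu.
Proof.
move=> munu le_head j.
have split_sum (xi : 'rV[R]_k) : \sum_(l < k | (j <= l)%N) xi 0 l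
    = \sum_l xi 0 l - \sum_(l < k | (l < j)%N) xi 0 l.
  rewrite [X in X - _](bigID (fun l : 'I_k => (l < j)%N)) /= addrAC subrr add0r.
  by apply: eq_bigl => l; rewrite -leqNgt.
by rewrite !split_sum munu lerD2l lerN2.
Qed.

End AbsorbingLastState.

Theorem theorem6 (R : realType) (k : nat) (hk : (1 <= k)%N)
    (Pt P : 'M[R]_k.+1)
    (hPt : stochastic Pt) (hP : stochastic P)
    (hPtkk : Pt ord_max ord_max = 1) (hPkk : P ord_max ord_max = 1)
    (hPtk : forall i : 'I_k.+1, (i < k)%N -> Pt i ord_max < 1)
    (herg : ergodic (taboo Pt))
    (hgap : spectral_gap Pt < spectral_gap P) :
  exists n0 : nat, forall n : nat, (n0 <= n)%N -> mx_st_le (Pt ^+ n) (P ^+ n).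
Proof.
(* Writing the number of transient states as a successor gives their matrices a ring structure and
   provides the state 0; the absorbing state is now [k.+1]. *)
case: k hk Pt P hPt hP hPtkk hPkk hPtk herg hgap => // k hk Pt P hPt hP
  hPtkk hPkk hPtk herg hgap.
have absPt : absorbing Pt by [].
have absP : absorbing P by [].
have [[z zPt zE] _] := second_modulus_absorbing hk absPt.
have [[w _ wE] leP] := second_modulus_absorbing hk absP.
have {hgap} : second_modulus P < second_modulus Pt.
  by move: hgap; rewrite /spectral_gap ltrD2l ltrN2.
set s := second_modulus P in leP wE *; rewrite -zE; set r := normc z => sr.
have s0 : 0 <= s by rewrite -wE normc_ge0.
(* The rate [s] itself may fail for the powers of [transient P], because of Jordan blocks; any rate
   strictly above it works. *)
have [x /andP[sx xr]] : exists x, s < x < r.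
  by exists ((s + r) / 2); apply/andP; split; lra.
have x0 : 0 < x := le_lt_trans s0 sx.
have Qt0 i j : 0 <= transient Pt i j by rewrite mxE hPt.1.
have [m _ hm] := herg.
have taboo0 i j : 0 <= taboo Pt i j.
  rewrite mxE; apply: divr_ge0; first exact: hPt.1.
  by rewrite subr_ge0 ltW // hPtk //= ltn_ord.
(* Conditioning only divides each row by a positive number, so both matrices have the same positive
   entries. *)
have Qtm i j : 0 < (transient Pt ^+ m) i j.
  apply: (expmx_gt0_support taboo0 Qt0) (hm i j) => a b; rewrite !mxE.
  by rewrite pmulr_lgt0 // invr_gt0 subr_gt0 hPtk //= ltn_ord.
have [c c0 cPt] := expmx_lower_bound Qt0 Qtm zPt.
have sx' : 0 <= s < x by rewrite s0 sx.
have [C C0 CP] := expmx_upper_bound sx' leP.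
have xr' : 0 < x < r by rewrite x0.
(* A head sum has at most [k.+2] terms, each at most [C * x ^+ n]. With [n = m + p + m], the factor
   [x ^+ (m + m)] is split off, so as to compare at exponent [p]. *)
have [n0 hn0] := eventually_geometric_le (k.+2%:R * C * x ^+ (m + m)) xr' c0.
exists (m + m + n0)%N => n nn0 i j ij.
have [Ptn _] := absorbing_exp n absPt.
have [Pn Pnkk] := absorbing_exp n absP.
have absPn := absorbing_exp n absP.
apply: st_le_complement => [|l].
  under eq_bigr do rewrite mxE. under [RHS]eq_bigr do rewrite mxE.
  by rewrite Ptn.2 Pn.2.
rewrite (eq_bigr (fun a => (P ^+ n) j a)) => [|a _]; last by rewrite mxE.
rewrite [X in _ <= X](eq_bigr (fun a => (Pt ^+ n) i a)) => [|a _]; last by rewrite mxE.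
have widenE (a b : 'I_k.+2) : (a < b)%N -> exists a', a = widen_ord (leqnSn k.+1) a'.
  move=> ab; have ak : (a < k.+1)%N := leq_trans ab (leq_ord b).
  by exists (Ordinal ak); apply: val_inj.
(* From the absorbing state, [P] gives no mass to the states below [l]. *)
have [jk|jk] := ltnP j k.+1; last first.
  have -> : j = ord_max by apply: val_inj; apply: anti_leq; rewrite leq_ord.
  rewrite big1 => [|a al]; first by rewrite sumr_ge0 // => a _; exact: Ptn.1.
  by have [a' ->] := widenE _ _ al; rewrite absorbing_row.
have [j' jE] := widenE j ord_max jk.
have [i' iE] := widenE i ord_max (leq_ltn_trans ij jk).
(* For [l = 0] both heads are empty; otherwise the head for [Pt] contains state 0, whose mass alone
   will suffice. *)
have [l0|l0] := posnP l; first by rewrite !big_pred0 // => a; rewrite l0 ltn0.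
have -> : n = (m + (n - (m + m)) + m)%N.
  by rewrite addnAC subnKC // (leq_trans _ nn0) // leq_addr.
set p := (n - _)%N.
apply: (@le_trans _ _ (c * r ^+ p)); last first.
  apply: le_trans (cPt p i' ord0) _.
  rewrite -transient_exp // mxE -iE.
  rewrite (bigD1 (widen_ord (leqnSn k.+1) ord0)) //= lerDl sumr_ge0 // => a _.
  exact: (absorbing_exp _ absPt).1.1.
apply: (@le_trans _ _ (k.+2%:R * C * x ^+ (m + m) * x ^+ p)); last first.
  by apply: hn0; rewrite leq_subRL // (leq_trans _ nn0) // leq_addr.
apply: (@le_trans _ _ (\sum_(a < k.+2) C * x ^+ (m + p + m))); last first.
  by rewrite sumr_const card_ord (addnAC m) exprD -!mulrA mulr_natl.
rewrite big_mkcond ler_sum // => a _; case: ifP => al.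
  have [a' ->] := widenE _ _ al.
  by have := CP (m + p + m)%N j' a'; rewrite -transient_exp // mxE jE.
by rewrite mulr_ge0 // exprn_ge0 // ltW.
Qed.
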